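(* Let $N>2$, let $\lambda>0$, let $H$ be a real matrix with $N$ columns, let $y$ be a real vector of matching dimension, and let $a=(a_1,a_2)$ with $a_i\ge 0$. Let $\psi(\,\cdot\,;a)$ and $S(\,\cdot\,;a)$ be the bivariate functions defined in the context from a univariate penalty $\phi$ satisfying properties P1–P10. Define $F,\Theta(\,\cdot\,;a)\colon\mathbb{R}^N\to\mathbb{R}$ by $$F(x)=\tfrac12\|y-Hx\|_2^2+\frac{\lambda}{2}\sum_{n=1}^{N+1}\psi\big((x_{n-1},x_n);a\big),\qquad \Theta(x;a)=\frac12\sum_{n=1}^{N+1}S\big((x_{n-1},x_n);a\big),$$ with the convention $x_0:=0$, $x_{N+1}:=0$. If $a$ is chosen so that $F$ is convex, then $x^{\mathsf{opt}}\in\mathbb{R}^N$ minimizes $F$ if and only if $$\frac1\lambda\big[H^{\mathsf T}(y-Hx^{\mathsf{opt}})\big]_n-\big[\nabla\Theta(x^{\mathsf{opt}};a)\big]_n\in\operatorname{sign}(x^{\mathsf{opt}}_n),\qquad n=1,\dots,N,$$ where $\operatorname{sign}$ is the set-valued signum function and $$[\nabla\Theta(x;a)]_n=\tfrac12 S_1\big((x_n,x_{n+1});a\big)+\tfrac12 S_2\big((x_{n-1},x_n);a\big),$$ $S_i$ denoting the partial derivative of $S(\,\cdot\,;a)$ with respect to its $i$-th variable.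
   Context: Set-valued signum: $\operatorname{sign}(t)=\{1\}$ if $t>0$, $[-1,1]$ if $t=0$, $\{-1\}$ if $t<0$. Univariate penalty: a family of functions $\phi(\,\cdot\,;a)\colon \mathbb{R}\to\mathbb{R}$, indexed by $a \ge 0$, with the following properties for all $a\ge 0$ (derivatives $\phi',\phi''$ are with respect to $t$; $0^+$ denotes the right-hand limit at $0$): P1) $\phi(\,\cdot\,;a)$ is continuous on $\mathbb{R}$; P2) $\phi(\,\cdot\,;a)$ is twice continuously differentiable, increasing and concave on $\mathbb{R}_+ = (0,\infty)$; P3) $\phi(0;a)=0$; P4) $\phi(t;0)=|t|$; P5) $\phi(-t;a)=\phi(t;a)$; P6) $\phi'(0^+;a)=1$; P7) $\phi''(0^+;a)=-a$; P8) $\phi''(t;a)\ge -a$ for all $t\ne 0$; P9) for each $t$, $\phi(t;a)$ is decreasing (non-strictly) and convex in $a$; P10) $\phi(t;a) = (b/a)\,\phi(at/b;b)$ for all $a,b>0$. Define $s(t;a)=\phi(t;a)-|t|$. Bivariate function $S$: let $a=(a_1,a_2)$ with $a_i\ge 0$. If at least one $a_i$ is non-zero, put $\alpha = \frac{a_1+a_2}{2}$, $r=\frac{a_1-a_2}{a_1+a_2}$, and define $S(\,\cdot\,;a)\colon\mathbb{R}^2\to\mathbb{R}$ by $$S(x;a)=\begin{cases} s(x_1+rx_2;\alpha)+(1-r)\,s(x_2;a_1), & x\in A_1\\ s(rx_1+x_2;\alpha)+(1-r)\,s(x_1;a_1), & x\in A_2\\ s(rx_1+x_2;\alpha)+(1+r)\,s(x_1;a_2),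 & x\in A_3\\ s(x_1+rx_2;\alpha)+(1+r)\,s(x_2;a_2), & x\in A_4\end{cases}$$ where $A_1=\{x: x_2(x_1-x_2)\ge 0\}$, $A_2=\{x: x_1(x_1-x_2)\le 0\}$, $A_3=\{x: x_1(x_1+x_2)\le 0\}$, $A_4=\{x: x_2(x_1+x_2)\le 0\}$ (the formulas agree on overlaps). If $a_1=a_2=0$, $S(x;0)=0$. The function $S(\,\cdot\,;a)$ is differentiable on $\mathbb{R}^2$. Bivariate penalty: $\psi(x;a)=S(x;a)+\|x\|_1$, where $\|x\|_1=|x_1|+|x_2|$. *)

(* Defs.v *)
From HB Require Import structures.
From mathcomp Require Import all_boot all_order all_algebra.
From mathcomp Require Import all_classical all_reals all_analysis.
Set Implicit Arguments.
Unset Strict Implicit.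
Unset Printing Implicit Defensive.
Import Order.TTheory GRing.Theory Num.Theory.
Import numFieldNormedType.Exports.
Local Open Scope ring_scope.
Local Open Scope classical_set_scope.

Definition set_sign (R : realType) (t : R) : set R :=
  if 0 < t then [set 1] else if t == 0 then `[-1, 1] else [set -1].

(* [phi a t] is the value at t of the penalty with parameter a; only the
   parameters a >= 0 are constrained.  Monotonicity is non-strict throughout. *)
Record univariate_penalty (R : realType) (phi : R -> R -> R) : Prop := {
  pen_continuous : forall a : R, 0 <= a -> continuous (phi a);
  pen_C2 : forall a t : R, 0 <= a -> 0 < t ->
    [/\ derivable (phi a) t 1, derivable (phi a)^`() t 1
      & {for t, continuous (phi a)^`(2)}];
  pen_increasing : forall a t u : R, 0 <= a -> 0 < t -> t <= u ->
    phi a t <= phi a u;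
  pen_concave : forall a : R, 0 <= a ->
    convex_function [set t : R | 0 < t] (fun t : R => - phi a t);
  pen_at0 : forall a : R, 0 <= a -> phi a 0 = 0;
  pen_abs : forall t : R, phi 0 t = `|t|;
  pen_even : forall a t : R, 0 <= a -> phi a (- t) = phi a t;
  pen_derive1_0 : forall a : R, 0 <= a ->
    (phi a)^`() t @[t --> 0^'+] --> (1 : R);
  pen_derive2_0 : forall a : R, 0 <= a ->
    (phi a)^`(2) t @[t --> 0^'+] --> - a;
  pen_derive2_ge : forall a t : R, 0 <= a -> t != 0 -> - a <= (phi a)^`(2) t;
  pen_param_decreasing : forall t a b : R, 0 <= a -> a <= b ->
    phi b t <= phi a t;
  pen_param_convex : forall t : R,
    convex_function [set a : R | 0 <= a] (fun a : R => phi a t);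
  pen_scaling : forall a b t : R, 0 < a -> 0 < b ->
    phi a t = b / a * phi b (a * t / b)
}.

Definition pen_smooth (R : realType) (phi : R -> R -> R) (a t : R) : R :=
  phi a t - `|t|.

(* The four closed regions cover the plane (A1 and A4 cover |x2| <= |x1|, A2
   and A3 cover |x1| <= |x2|), so the last branch is the region
   x2 * (x1 + x2) <= 0 minus the previous ones.  When phi is a univariate
   penalty the formulas agree on overlaps, so the order of the tests is
   irrelevant. *)
Definition bivariate_S (R : realType) (phi : R -> R -> R) (a x : R * R) : R :=
  let s := pen_smooth phi in
  let alpha := (a.1 + a.2) / 2 in
  let r := (a.1 - a.2) / (a.1 + a.2) in
  if (a.1 == 0) && (a.2 == 0) then 0
  else if 0 <= x.2 * (x.1 - x.2) then
    s alpha (x.1 + r * x.2) + (1 - r) * s a.1 x.2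
  else if x.1 * (x.1 - x.2) <= 0 then
    s alpha (r * x.1 + x.2) + (1 - r) * s a.1 x.1
  else if x.1 * (x.1 + x.2) <= 0 then
    s alpha (r * x.1 + x.2) + (1 + r) * s a.2 x.1
  else
    s alpha (x.1 + r * x.2) + (1 + r) * s a.2 x.2.

Definition bivariate_penalty (R : realType) (phi : R -> R -> R)
    (a x : R * R) : R :=
  bivariate_S phi a x + (`|x.1| + `|x.2|).

(* The entry x_k in 1-based numbering, with x_k = 0 for k = 0 and for k > N;
   x_k is stored in row k - 1 of the column vector x. *)
Definition entry (R : realType) (N : nat) (x : 'cV[R]_N) (k : nat) : R :=
  if k is k'.+1 then oapp (fun i : 'I_N => x i 0) 0 (insub k') else 0.

(* The normed-module norm `|v| on matrices is the sup norm, hence this. *)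
Definition sqr_norm2 (R : realType) (M : nat) (v : 'cV[R]_M) : R :=
  \sum_(i < M) v i 0 ^+ 2.

Definition objective (R : realType) (M N : nat) (phi : R -> R -> R)
    (lambda : R) (H : 'M[R]_(M, N)) (y : 'cV[R]_M) (a : R * R)
    (x : 'cV[R]_N) : R :=
  2^-1 * sqr_norm2 (y - H *m x) +
  lambda / 2 * \sum_(1 <= n < N.+2)
                 bivariate_penalty phi a (entry x n.-1, entry x n).

Definition Theta (R : realType) (N : nat) (phi : R -> R -> R) (a : R * R)
    (x : 'cV[R]_N) : R :=
  2^-1 * \sum_(1 <= n < N.+2) bivariate_S phi a (entry x n.-1, entry x n).

Definition gradient (R : realType) (N : nat) (f : 'cV[R]_N -> R)
    (x : 'cV[R]_N) : 'cV[R]_N :=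
  \col_n 'D_(delta_mx n 0) f x.

Definition partial1 (R : realType) (f : R * R -> R) (x : R * R) : R :=
  'D_(1, 0) f x.

Definition partial2 (R : realType) (f : R * R -> R) (x : R * R) : R :=
  'D_(0, 1) f x.

(* Main.v *)
Require Import Defs.
From HB Require Import structures.
From mathcomp Require Import all_boot all_order all_algebra.
From mathcomp Require Import all_classical all_reals all_analysis.
From mathcomp Require Import ring lra.
Set Implicit Arguments.
Unset Strict Implicit.
Unset Printing Implicit Defensive.
Import Order.TTheory GRing.Theory Num.Theory.
Import numFieldNormedType.Exports.
Local Open Scope ring_scope.
Local Open Scope classical_set_scope.

(** Write [S] for the bivariate smooth part and [|x|_1] for the l1 norm.  Every
    entry of [x] occurs in exactly two of the pairs (x_{n-1}, x_n), so the
    objective is [G x + lambda * |x|_1] with [G] the sum of half the squared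
    residual and [lambda * Theta].  Once [G] is known to be differentiable,
    minimality is a statement about the l1 norm alone
    ([convex_composite_min]): [x] minimizes a convex function [G + P], with
    [P] convex, if and only if [P (x + d) >= P x - 'd G x d] for all [d].  In
    one direction the difference quotients of [G] are bounded below through
    the convexity of [P], in the other they are bounded above through the
    convexity of [G + P]; [G] itself need not be convex.  For
    [P = lambda * |.|_1] the inequality separates over the coordinates
    ([l1norm_subgradient]): each coordinate of [- 'd G x / lambda] has to be a
    subgradient of the absolute value, that is, to lie in the set-valued sign
    ([set_sign_subgradient]).

    The differentiability of [G] rests on that of [S].  First,
    [s = phi - |.|] is differentiable on the whole line: at 0 the mean value
    theorem turns the limit 1 of [phi'] into the estimate [s t = o(t)].  Next,
    with [alpha = (a1 + a2) / 2] and [r = (a1 - a2) / (a1 + a2)] one has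
    [a1 = alpha * (1 + r)] and [a2 = alpha * (1 - r)], so the scaling law
    expresses all the terms of [S] through the single even function
    [g = s(.; alpha)].  On the sector where [u] is the coordinate of larger
    modulus, [v] the other one and [sigma] the sign of [u * v], this gives
    [S = g (u + r v) + (1 - sigma r) / (1 + sigma r) * g ((1 + sigma r) v)].
    Each of these four expressions is differentiable on the whole plane.  On
    the common boundary of two sectors both the values and the differentials
    agree: where [v = 0] because [g 0 = g' 0 = 0], and on the diagonals
    because [g] is even and all the arguments of [g] become equal up to sign.
    Functions that agree to first order on finitely many closed sets glue to
    a differentiable function ([is_diff_glue]). *)

(** * The smooth part of the univariate penalty *)

Section SmoothPart.
Context (R : realType) (phi : R -> R -> R) (hphi : univariate_penalty phi).
Implicit Types a b t : R.

Lemma pen_smooth_even a t : 0 <= a ->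
  pen_smooth phi a (- t) = pen_smooth phi a t.
Proof. by move=> a0; rewrite /pen_smooth (pen_even hphi) // normrN. Qed.

Lemma pen_smooth_at0 a : 0 <= a -> pen_smooth phi a 0 = 0.
Proof. by move=> a0; rewrite /pen_smooth (pen_at0 hphi) // normr0 subr0. Qed.

Lemma pen_smooth_norm a t : 0 <= a ->
  pen_smooth phi a `|t| = pen_smooth phi a t.
Proof.
move=> a0; have [t0|t0] := leP 0 t; first by rewrite ger0_norm.
by rewrite ltr0_norm // pen_smooth_even.
Qed.

Lemma pen_smooth_param0 t : pen_smooth phi 0 t = 0.
Proof. by rewrite /pen_smooth (pen_abs hphi) subrr. Qed.

Lemma pen_smooth_scaling a b t : 0 < a -> 0 < b ->
  pen_smooth phi a t = b / a * pen_smooth phi b (a * t / b).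
Proof.
move=> a0 b0; rewrite /pen_smooth (pen_scaling hphi t a0 b0) mulrBr.
congr (_ - _); rewrite !normrM normfV (gtr0_norm a0) (gtr0_norm b0).
by field; rewrite !gt_eqF.
Qed.

(** Only the limit of [phi'] at [0^'+] is known; the mean value theorem on
    [0, t] converts it into [|s t| <= e * t] for small [t > 0], and evenness
    carries this bound over to negative [t]. *)
Lemma pen_smooth_derive_at0 a : 0 <= a ->
  is_derive (0 : R) (1 : R) (pen_smooth phi a) 0.
Proof.
move=> a0.
suff H : h^-1 *: ((pen_smooth phi a \o shift 0) (h *: 1) - pen_smooth phi a 0)
           @[h --> 0^'] --> (0 : R).
  by apply: DeriveDef; [apply/cvg_ex; exists 0|exact: cvg_lim H].
apply/cvgrPdist_le => e e0.
have /cvgrPdist_le /(_ e e0) := pen_derive1_0 hphi a0.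
move=> [d /= d0 Hd].
have small t : 0 < t -> t < d -> `|pen_smooth phi a t| <= t * e.
  move=> t0 td.
  have [|c] := @MVT R (phi a) (phi a)^`() 0 t t0 _
    (continuous_subspaceT (pen_continuous hphi a0)).
    move=> x; rewrite in_itv/= => /andP[x0 _].
    have [dx _ _] := pen_C2 hphi a0 x0.
    by rewrite derive1E; exact: derivableP.
  rewrite in_itv/= (pen_at0 hphi) // !subr0 => /andP[c0 ct] E.
  rewrite /pen_smooth E (gtr0_norm t0) -[X in _ - X]mul1r -mulrBl.
  rewrite normrM (gtr0_norm t0) mulrC ler_pM2l // distrC; apply: Hd => //=.
  by rewrite sub0r normrN gtr0_norm // (lt_trans ct).
near=> h.
have h0 : h != 0 by near: h; exact: nbhs_dnbhs_neq.
have hd : `|h| < d by near: h; exact: dnbhs0_lt.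
rewrite /= addr0 pen_smooth_at0 // subr0 sub0r normrN [h%:A]mulr1 normrZ normfV.
rewrite ler_pdivrMl ?normr_gt0 // -(pen_smooth_norm h) //.
by apply: small; rewrite ?normr_gt0.
Unshelve. all: by end_near. Qed.

(** Away from 0 the absolute value is smooth, and the negative half-line
    reduces to the positive one by evenness. *)
Lemma pen_smooth_derivable a t : 0 <= a -> derivable (pen_smooth phi a) t 1.
Proof.
move=> a0.
have pos u : 0 < u -> derivable (pen_smooth phi a) u 1.
  move=> u0; have [du _ _] := pen_C2 hphi a0 u0.
  apply: (@near_eq_derivable _ _ _ (phi a - id)) => //.
  - near=> x; rewrite /pen_smooth gtr0_norm //.
    by near: x; exact: lt_nbhsr.
  - by apply: derivableB.
have [t0|t0|<-] := ltgtP 0 t.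
- exact: pos.
- have -> : pen_smooth phi a = pen_smooth phi a \o -%R.
    by apply/funext => x /=; rewrite pen_smooth_even.
  apply/derivable1_diffP; apply: differentiable_comp.
    exact/derivable1_diffP/derivable_opp.
  by apply/derivable1_diffP/pos; rewrite oppr_gt0.
- by have := pen_smooth_derive_at0 a0; case.
Unshelve. all: by end_near. Qed.

End SmoothPart.

Lemma derive1_even (R : realFieldType) (g : R -> R) t : derivable g t 1 ->
  (forall x, g (- x) = g x) -> g^`()%classic (- t) = - g^`()%classic t.
Proof.
move=> dg ev.
have E : g = g \o -%R by apply/funext => x /=; rewrite ev.
rewrite {1}E derive1_comp ?opprK //.
by rewrite derive1N ?derive1_id ?mulrN1.
Qed.

(** * Gluing differentiable functions *)

(** A closed set that misses [z] misses a neighbourhood of [z], so near [z] the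
    function [f] takes only values of those [p i] with [z] in [A i].  These
    have the same first-order expansion at [z], hence so has [f]. *)
Lemma is_diff_glue (R : realType) (V W : normedModType R) (I : finType)
    (A : I -> set V) (p : I -> V -> W) (f L : V -> W) (z : V) :
  (forall i, closed (A i)) ->
  (forall x, exists2 i, A i x & f x = p i x) ->
  (forall i, A i z -> p i z = f z) ->
  (forall i, A i z -> is_diff z (p i) L) ->
  is_diff z f L.
Proof.
move=> Acl fp pz pL.
have [j Ajz _] := fp z.
have [dj Lj] := pL _ Ajz.
have fL : f \o shift z = cst (f z) + 'd (p j) z +o_ 0 id.
  apply/eqaddoP => e e0.
  have small i : \forall h \near (0 : V), A i (h + z) ->
      `|p i (h + z) - (f z + L h)| <= e * `|h|.
    have [Aiz|nAiz] := pselect (A i z).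
      have [di Li] := pL _ Aiz.
      have /eqaddoP /(_ e e0) := diff_locally di.
      apply: filterS => h + _; rewrite -Li -(pz _ Aiz); exact.
    have : \forall x \near z, (~` A i) x.
      by apply: open_nbhs_nbhs; split=> //; exact: closed_openC.
    rewrite (near_shift 0 z); apply: filterS => h /=; rewrite subr0 => nA /nA.
    by [].
  apply: filterS (filter_forall _ small) => h smallh.
  have [i Ai fi] := fp (h + z).
  by have := smallh i Ai; rewrite -fi -Lj; exact.
have fd : 'd f z = 'd (p j) z :> (V -> W).
  by apply: diff_unique fL; exact: diff_continuous.
split; last by rewrite fd Lj.
apply/diff_locallyP; rewrite fd; split => //; exact: diff_continuous.
Qed.

(** * Functions given by four formulas on the sectors of the plane *)

Lemma is_diff_linear (R : realType) (V W : normedModType R) (f : V -> W)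
    (x : V) : linear f -> continuous f -> is_diff x f f.
Proof.
move=> lf cf; pose fM := GRing.isLinear.Build _ _ _ _ _ lf.
pose fL : {linear _ -> _} := HB.pack f fM.
have -> : f = fL by [].
by apply: DiffDef; [exact: linear_differentiable|rewrite diff_lin].
Qed.

Section Sectors.
Context (R : realType).
Implicit Types (z h : R * R) (g : R -> R) (r : R) (i : bool * bool).

(** The four sectors cut out by the axes and the diagonals are indexed by a
    pair of booleans: the first component tells whether the second coordinate
    has the larger modulus, the second whether the coordinates have opposite
    signs. *)
Definition major (sw : bool) z : R := if sw then z.2 else z.1.
Definition minor (sw : bool) z : R := major (~~ sw) z.

(** For [m] the minor and [M] the major coordinate and [s] a sign,
    [m ^ 2 <= s * (M * m)] says that [m] lies between 0 and [s * M]. *)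
Definition sector i : set (R * R) :=
  [set z | minor i.1 z ^+ 2 <= (-1) ^+ i.2 * (major i.1 z * minor i.1 z)].

Definition piece g r i z : R :=
  g (major i.1 z + r * minor i.1 z) +
  (1 - (-1) ^+ i.2 * r) / (1 + (-1) ^+ i.2 * r) *
    g ((1 + (-1) ^+ i.2 * r) * minor i.1 z).

(** The factor [1 + (-1) ^ e * r] produced by the chain rule in the second
    summand of [piece] cancels the denominator; when it vanishes, so does the
    derivative of [g] in that summand, and the formula remains correct. *)
Definition piece_diff g r i z h : R :=
  (major i.1 h + r * minor i.1 h) *
    g^`()%classic (major i.1 z + r * minor i.1 z) +
  (1 - (-1) ^+ i.2 * r) *
    (minor i.1 h * g^`()%classic ((1 + (-1) ^+ i.2 * r) * minor i.1 z)).

Lemma major_continuous (sw : bool) : continuous (major sw).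
Proof.
by rewrite /major; case: sw => y; [exact: cvg_snd|exact: cvg_fst].
Qed.

Lemma closed_sector i : closed (sector i).
Proof.
pose F z := (-1) ^+ i.2 * (major i.1 z * minor i.1 z) - minor i.1 z ^+ 2.
have cF : continuous F.
  move=> z; apply: cvgB; last first.
    by rewrite expr2; apply: cvgM; exact: major_continuous.
  by apply: cvgM; [exact: cvg_cst|apply: cvgM; exact: major_continuous].
have -> : sector i = F @^-1` [set x | 0 <= x].
  by apply/seteqP; split=> z /=; rewrite /F subr_ge0.
by apply: preimage_closed => [z _|]; [exact: cF|exact: closed_ge].
Qed.

Variables (g : R -> R) (r : R).
Hypotheses (dg : forall t, derivable g t 1) (g_even : forall t, g (- t) = g t)
  (g0 : g 0 = 0).

Let dg0 : g^`()%classic 0 = 0.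
Proof.
have := derive1_even (@dg 0) g_even; rewrite oppr0 => /eqP.
by rewrite -addr_eq0 -mulr2n mulrn_eq0 => /eqP.
Qed.

Lemma is_diff_derivable_comp (V : normedModType R) (l dl : V -> R) (x : V) :
  is_diff x l dl ->
  is_diff x (g \o l) (fun h : V => dl h * g^`()%classic (l x)).
Proof.
move=> ?; apply: is_diff_eq.
  apply: is_diff_comp; apply: DiffDef; first exact/derivable1_diffP/dg.
  by rewrite deriv1E.
by [].
Qed.

Lemma is_diff_piece i z : is_diff z (piece g r i) (piece_diff g r i z).
Proof.
case: i => sw e; rewrite /piece /piece_diff /=.
set s := (-1) ^+ e.
have d1 : is_diff z (fun z => major sw z + r * minor sw z)
                    (fun z => major sw z + r * minor sw z).
  apply: is_diff_linear => [k x y|x].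
    by rewrite /minor /major; case: (sw) => /=; rewrite /GRing.scale /=; ring.
  apply: cvgD; first exact: major_continuous.
  by apply: cvgM; [exact: cvg_cst|exact: major_continuous].
have d2 : is_diff z (fun z => (1 + s * r) * minor sw z)
                    (fun z => (1 + s * r) * minor sw z).
  apply: is_diff_linear => [k x y|x].
    by rewrite /minor /major; case: (sw) => /=; rewrite /GRing.scale /=; ring.
  by apply: cvgM; [exact: cvg_cst|exact: major_continuous].
have {}d1 := is_diff_derivable_comp d1.
have {}d2 := is_diff_derivable_comp d2.
have := is_diffD d1 (is_diffZ ((1 - s * r) / (1 + s * r)) d2).
congr (is_diff_def _ _ _); apply/funext => h; rewrite !fctE; congr (_ + _).
rewrite -[_ *: _]/(_ * _) /= -!mulrA.
have [->|b0] := eqVneq (1 + s * r) 0; last by rewrite mulKf.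
by rewrite !mul0r dg0 !mulr0.
Qed.

Let g_sign (e : bool) t : g ((-1) ^+ e * t) = g t.
Proof. by case: e; rewrite ?mul1r // expr1 mulN1r g_even. Qed.

Let dg_sign (e : bool) t :
  g^`()%classic ((-1) ^+ e * t) = (-1) ^+ e * g^`()%classic t.
Proof. by case: e; rewrite ?mul1r // expr1 !mulN1r derive1_even. Qed.

(** Across a coordinate axis the second summands differ, but they vanish there
    to first order, as [g 0 = g' 0 = 0]. *)
Lemma piece_minor0 sw e e' z : minor sw z = 0 ->
  piece g r (sw, e) z = piece g r (sw, e') z /\
  piece_diff g r (sw, e) z = piece_diff g r (sw, e') z.
Proof.
move=> m0; rewrite /piece /piece_diff /= m0 !mulr0 g0 dg0.
by split; [rewrite !mulr0|apply/funext => h; rewrite !mulr0].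
Qed.

(** The right-hand sides do not depend on [sw], so this is the agreement of two
    neighbouring pieces along a diagonal: there the arguments of [g] in both
    pieces are [b * z.1] up to sign. *)
Lemma piece_diagonal (sw e : bool) z : z.2 = (-1) ^+ e * z.1 ->
  let b := 1 + (-1) ^+ e * r in
  piece g r (sw, e) z = g (b * z.1) + (1 - (-1) ^+ e * r) / b * g (b * z.1) /\
  piece_diff g r (sw, e) z =
    (fun h => (h.1 + (-1) ^+ e * h.2) * g^`()%classic (b * z.1)).
Proof.
move=> zE /=; set b := 1 + _.
have eB : b * ((-1) ^+ e * z.1) = (-1) ^+ e * (b * z.1) by rewrite mulrCA.
have eT : z.1 + r * ((-1) ^+ e * z.1) = b * z.1 by rewrite /b; ring.
have eF : (-1) ^+ e * z.1 + r * z.1 = (-1) ^+ e * (b * z.1).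
  by rewrite /b; case: e {zE b eB eT}; rewrite ?expr0 ?expr1; ring.
rewrite /piece /piece_diff /minor /major /= -/b zE.
split; [|apply/funext => h]; case: sw => /=.
- by rewrite eF g_sign.
- by rewrite eT eB g_sign.
- rewrite eF dg_sign /b; move: (g^`()%classic _) => d.
  by case: e {zE b eB eT eF}; rewrite ?expr0 ?expr1; ring.
- rewrite eT eB dg_sign /b; move: (g^`()%classic _) => d.
  by case: e {zE b eB eT eF}; rewrite ?expr0 ?expr1; ring.
Qed.

Let sqr_le0 (t : R) : t ^+ 2 <= 0 -> t = 0.
Proof. by move=> t0; apply/eqP; rewrite -sqrf_eq0 eq_le t0 sqr_ge0. Qed.

(** Two sectors with the same major coordinate meet on an axis, two with the
    same sign on a diagonal, and opposite ones only at the origin. *)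
Lemma piece_agree i j z : sector i z -> sector j z ->
  piece g r i z = piece g r j z /\ piece_diff g r i z = piece_diff g r j z.
Proof.
case: i j => sw e [sw' e']; rewrite /sector /=.
have [<-{sw'}|swN] := eqVneq sw sw'.
  have [<- //|eN] := eqVneq e e'; move=> se se'; apply: piece_minor0.
  apply: sqr_le0; move: eN se se'; move: (major sw z * _) => w.
  by case: e; case: e' => //= _; rewrite ?expr0 ?expr1 => *; lra.
have {swN} -> : sw' = ~~ sw by case: sw sw' swN => [] [].
rewrite /minor negbK.
have [<-|eN] := eqVneq e e'; move=> se se'.
  have zE : z.2 = (-1) ^+ e * z.1.
    apply/eqP; rewrite -subr_eq0; apply/eqP/sqr_le0.
    move: se se'; rewrite /major; case: sw; case: (e);
      rewrite /= ?expr0 ?expr1 => *; nra.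
  have [-> ->] := piece_diagonal sw zE.
  by have [-> ->] := piece_diagonal (~~ sw) zE.
have z0 b : major b z = 0.
  apply: sqr_le0; move: eN se se'; have := sqr_ge0 (major true z).
  have := sqr_ge0 (major false z).
  rewrite /major; case: b; case: sw; case: e; case: e' => //;
      rewrite /= ?expr0 ?expr1 => *; lra.
rewrite /piece /piece_diff /minor /= !z0 !mulr0 !addr0 !g0 dg0 !mulr0 !addr0.
by split=> //; apply/funext => h; rewrite !mulr0 addr0.
Qed.

Lemma is_diff_pieces (f : R * R -> R) :
  (forall z, exists2 i, sector i z & f z = piece g r i z) ->
  forall z, differentiable f z.
Proof.
move=> fp z; have [j jz fj] := fp z.
suff [] : is_diff z f (piece_diff g r j z) by [].
apply: (is_diff_glue closed_sector fp) => i iz.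
  by rewrite fj; case: (piece_agree iz jz).
by have [_ <-] := piece_agree iz jz; exact: is_diff_piece.
Qed.

End Sectors.

(** * Differentiability of the bivariate function *)

(** When [b = 0] both sides vanish, the left one because the penalty with
    parameter 0 is the absolute value. *)
Lemma pen_smooth_rescale (R : realType) (phi : R -> R -> R) (c b k t : R) :
  univariate_penalty phi -> 0 < c -> 0 <= b ->
  k * pen_smooth phi (c * b) t = k / b * pen_smooth phi c (b * t).
Proof.
move=> hphi c0; rewrite le_eqVlt => /predU1P[<-|b0].
  by rewrite mulr0 mul0r (pen_smooth_param0 hphi) pen_smooth_at0 ?ltW // !mulr0.
rewrite (pen_smooth_scaling hphi t (mulr_gt0 c0 b0) c0) mulrA.
congr (_ * pen_smooth phi c _); field; rewrite ?(gt_eqF b0) ?(gt_eqF c0) //.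
Qed.

(** The parameters satisfy [a1 = c * (1 + r)] and [a2 = c * (1 - r)] for [c]
    their mean, so [pen_smooth_rescale] rewrites every branch of
    [bivariate_S] in terms of the parameter [c] only. *)
Lemma bivariate_S_pieces (R : realType) (phi : R -> R -> R) (a z : R * R) :
  univariate_penalty phi -> 0 <= a.1 -> 0 <= a.2 -> 0 < a.1 + a.2 ->
  exists2 i, sector i z &
    bivariate_S phi a z =
      piece (pen_smooth phi ((a.1 + a.2) / 2)) ((a.1 - a.2) / (a.1 + a.2)) i z.
Proof.
move=> hphi a1 a2 a12; rewrite /bivariate_S.
case: ifPn => [/andP[/eqP e1 /eqP e2]|_].
  by rewrite e1 e2 addr0 ltxx in a12.
set c := _ / 2; set r := _ / _.
have c0 : 0 < c by rewrite divr_gt0.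
have s0 : a.1 + a.2 != 0 by rewrite gt_eqF.
have E1 : a.1 = c * (1 + (-1) ^+ false * r).
  by rewrite /c /r expr0; field.
have E2 : a.2 = c * (1 + (-1) ^+ true * r).
  by rewrite /c /r expr1; field.
have b1 : 0 <= 1 + (-1) ^+ false * r by rewrite -(pmulr_rge0 _ c0) -E1.
have b2 : 0 <= 1 + (-1) ^+ true * r by rewrite -(pmulr_rge0 _ c0) -E2.
have T1 t : (1 - r) * pen_smooth phi a.1 t = (1 - (-1) ^+ false * r) /
    (1 + (-1) ^+ false * r) * pen_smooth phi c ((1 + (-1) ^+ false * r) * t).
  by rewrite {1}E1 pen_smooth_rescale // expr0 mul1r.
have T2 t : (1 + r) * pen_smooth phi a.2 t = (1 - (-1) ^+ true * r) /
    (1 + (-1) ^+ true * r) * pen_smooth phi c ((1 + (-1) ^+ true * r) * t).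
  by rewrite {1}E2 pen_smooth_rescale // expr1 mulN1r opprK.
rewrite !T1 !T2 /sector /piece /minor /major.
case: leP => A1.
  by exists (false, false) => //=; rewrite expr0; nra.
case: leP => A2.
  by exists (true, false); rewrite /= ?expr0 1?[r * _ + _]addrC //; nra.
case: leP => A3.
  by exists (true, true); rewrite /= ?expr1 1?[r * _ + _]addrC //; nra.
exists (false, true) => //=; rewrite expr1.
(* The failed tests exclude that the coordinates have the same sign. *)
have [xy0|xy0] := leP 0 (z.1 * z.2); nra.
Qed.

Lemma bivariate_S_differentiable (R : realType) (phi : R -> R -> R)
    (a z : R * R) :
  univariate_penalty phi -> 0 <= a.1 -> 0 <= a.2 ->
  differentiable (bivariate_S phi a) z.
Proof.
move=> hphi a1 a2; have := addr_ge0 a1 a2.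
rewrite le_eqVlt => /predU1P[/esym/eqP|a12].
  rewrite paddr_eq0 // => a0.
  suff -> : bivariate_S phi a = cst 0 by exact: differentiable_cst.
  by apply/funext => x; rewrite /bivariate_S a0.
have c0 : 0 <= (a.1 + a.2) / 2 by rewrite divr_ge0 ?ltW.
apply: (is_diff_pieces (g := pen_smooth phi ((a.1 + a.2) / 2))
                       (r := (a.1 - a.2) / (a.1 + a.2))).
- by move=> t; exact: pen_smooth_derivable.
- by move=> t; exact: pen_smooth_even.
- exact: pen_smooth_at0.
- by move=> x; exact: bivariate_S_pieces.
Qed.

(** * The gradient of the separable sum *)

Section Entries.
Context (R : realType) (N : nat).
Implicit Types (x h : 'cV[R]_N) (k : nat).

Lemma entry_linear k c x h :
  entry (c *: x + h) k = c * entry x k + entry h k.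
Proof.
case: k => [|k] /=; first by rewrite mulr0 addr0.
by case: insubP => [i _ _|_] /=; rewrite ?mxE // mulr0 addr0.
Qed.

Lemma entry_continuous k : continuous (fun x => entry x k).
Proof.
case: k => [|k]; first exact: cst_continuous.
rewrite /entry; case: insubP => [i _ _|_]; last exact: cst_continuous.
exact: coord_continuous.
Qed.

Lemma entry_ord x (n : 'I_N) : entry x n.+1 = x n 0.
Proof. by rewrite /= valK. Qed.

Lemma entry_last x : entry x N.+1 = 0.
Proof. by rewrite /= insubN ?ltnn. Qed.

Lemma entry_delta (n : 'I_N) k : entry (delta_mx n 0) k = (k == n.+1)%:R :> R.
Proof.
case: k => [|k] //=; rewrite eqSS.
case: insubP => [i _ <-|] /=; first by rewrite mxE eqxx andbT.
by case: eqP => // ->; rewrite ltn_ord.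
Qed.

Definition adjacent k x : R * R := (entry x k.-1, entry x k).

Lemma is_diff_adjacent k x : is_diff x (adjacent k) (adjacent k).
Proof.
apply: is_diff_linear => [c u v|u].
  by rewrite /adjacent !entry_linear.
exact: (cvg_pair (@entry_continuous k.-1 u) (@entry_continuous k u)).
Qed.

End Entries.

Lemma is_diff_sum (R : realType) (V W : normedModType R) (I : Type) (s : seq I)
    (f df : I -> V -> W) (x : V) :
  (forall i, is_diff x (f i) (df i)) ->
  is_diff x (fun x => \sum_(i <- s) f i x) (fun h => \sum_(i <- s) df i h).
Proof.
move=> dfi; elim: s => [|i s IH].
  have := is_diff_cst (0 : W) x.
  by congr (is_diff_def _ _ _); apply/funext => h; rewrite big_nil.
have := is_diffD (dfi i) IH.
by congr (is_diff_def _ _ _); apply/funext => h; rewrite big_cons.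
Qed.

Lemma is_diff_Theta (R : realType) (N : nat) (phi : R -> R -> R) (a : R * R)
    (x : 'cV[R]_N) :
  (forall z, differentiable (bivariate_S phi a) z) ->
  is_diff x (Theta phi a) (fun h => 2^-1 * \sum_(1 <= k < N.+2)
     'd (bivariate_S phi a) (adjacent k x) (adjacent k h)).
Proof.
move=> dS.
have dk k := is_diff_comp (is_diff_adjacent k x)
               (differentiableP (dS (adjacent k x))).
exact: is_diffZ (is_diff_sum _ dk).
Qed.

Lemma diff_gradient (R : realType) (N : nat) (f : 'cV[R]_N -> R)
    (x h : 'cV[R]_N) :
  differentiable f x ->
  'd f x h = \sum_n h n 0 * gradient f x n 0.
Proof.
move=> df; rewrite {1}(matrix_sum_delta h) linear_sum.
apply: eq_bigr => n _; rewrite big_ord1 linearZ /= mxE deriveE //.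
Qed.

Lemma diff_partials (R : realType) (f : R * R -> R) (z h : R * R) :
  differentiable f z ->
  'd f z h = h.1 * partial1 f z + h.2 * partial2 f z.
Proof.
move=> df; rewrite /partial1 /partial2 !deriveE //.
have -> : h = h.1 *: ((1, 0) : R * R) + h.2 *: ((0, 1) : R * R).
  by case: h => u v; congr pair;
    rewrite /= /GRing.scale /= ?mulr1 ?mulr0 ?addr0 ?add0r.
rewrite linearD !linearZ /=.
by rewrite /GRing.scale /= !mulr1 !mulr0 addr0 add0r.
Qed.

(** Moving the [n]-th coordinate changes only the pairs of index [n.+1], through
    their second component, and [n.+2], through their first. *)
Lemma gradient_Theta (R : realType) (N : nat) (phi : R -> R -> R) (a : R * R)
    (x : 'cV[R]_N) (n : 'I_N) :
  (forall z, differentiable (bivariate_S phi a) z) ->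
  gradient (Theta phi a) x n 0 =
    2^-1 * partial1 (bivariate_S phi a) (entry x n.+1, entry x n.+2) +
    2^-1 * partial2 (bivariate_S phi a) (entry x n, entry x n.+1).
Proof.
move=> dS; have [dT dTE] := is_diff_Theta x dS.
rewrite mxE deriveE // dTE -mulrDr; congr (_ * _).
under eq_bigr do rewrite diff_partials // /= !entry_delta.
have pick (F : nat -> R) j : (0 < j < N.+2)%N ->
    \sum_(1 <= k < N.+2) (k == j)%:R * F k = F j.
  move=> jN; rewrite (bigD1_seq j) ?iota_uniq ?mem_index_iota //= eqxx mul1r.
  by rewrite big1 ?addr0 // => k /negPf ->; rewrite mul0r.
have nN := ltn_ord n.
rewrite big_split; congr (_ + _).
  have := pick (fun k => partial1 (bivariate_S phi a) (adjacent k x)) n.+2 nN.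
  by move=> <-; apply: eq_bigr => -[].
exact: (pick (fun k => partial2 (bivariate_S phi a) (adjacent k x))
             n.+1 (ltnW nN)).
Qed.

(** * Minimizers of a differentiable plus a convex function *)

Lemma derive_upper_bound (R : realType) (V : normedModType R) (f : V -> R)
    (x d : V) (c : R) : derivable f x d ->
  (forall t, 0 < t -> t <= 1 -> f (t *: d + x) - f x <= t * c) ->
  'D_d f x <= c.
Proof.
move=> df fc; rewrite ['D_d f x]cvg_at_rightE //; apply: limr_le.
  rewrite -(cvg_at_rightE (fun h => h^-1 *: ((f \o shift x) _ - f x))) //.
  apply: cvg_trans df; apply: cvg_app.
  move=> A [e egt0 Ae]; exists e => // t te tgt0; apply: Ae => //.
  exact/lt0r_neq0.
near=> t.
have t0 : 0 < t by near: t; exact: nbhs_right_gt.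
rewrite /GRing.scale /= ler_pdivrMl //; apply: fc => //.
by near: t; exact: nbhs_right_le.
Unshelve. all: by end_near. Qed.

Lemma convex_chord (R : realType) (V : lmodType R) (f : V -> R) (x d : V)
    (t : R) : convex_function setT f -> 0 < t -> t <= 1 ->
  f (t *: d + x) - f x <= t * (f (d + x) - f x).
Proof.
move=> cf t0 t1.
have : f (t *: (d + x) + (1 - t) *: x) <= t * f (d + x) + (1 - t) * f x.
  exact: (cf (Itv01 (ltW t0) t1) (d + x) x (in_setT _) (in_setT _)).
by rewrite scalerDr -addrA -scalerDl [t + _]addrC subrK scale1r; lra.
Qed.

(** The right-hand side says that [- 'd G x] is a subgradient of [P] at [x].
    Minimality bounds the difference quotients of [- G] along [d] by those of
    [P], hence by [P (d + x) - P x]; conversely, the convexity of [G + P]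
    bounds the difference quotients of [G] from above, and the limit of this
    bound leaves exactly [G x + P x <= G z + P z]. *)
Lemma convex_composite_min (R : realType) (V : normedModType R)
    (G P : V -> R) (x : V) :
  differentiable G x -> convex_function setT P ->
  convex_function setT (fun z => G z + P z) ->
  (forall z, G x + P x <= G z + P z) <->
  (forall d, P x <= P (d + x) + 'd G x d).
Proof.
move=> dG cP cF; split=> [xmin d|subg z].
  have dNG : differentiable (- G) x by exact: differentiableN.
  have : 'D_d (- G) x <= P (d + x) - P x.
    apply: derive_upper_bound; first exact: diff_derivable.
    move=> t t0 t1; apply: le_trans (convex_chord _ _ cP t0 t1).
    have := xmin (t *: d + x); rewrite !fctE; lra.
  by rewrite deriveN ?deriveE //; [lra|exact: diff_derivable].
have : 'D_(z - x) G x <= 'd G x (z - x) + (G z + P z - (G x + P x)).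
  apply: derive_upper_bound; first exact: diff_derivable.
  move=> t t0 t1; have := convex_chord x (z - x) cF t0 t1.
  by have := subg (t *: (z - x)); rewrite subrK linearZ /= /GRing.scale /=; lra.
by rewrite deriveE //; lra.
Qed.

(** The set-valued sign is the subdifferential of the absolute value.  For
    [t != 0], testing the inequality at [s = t] and [s = - t] pins [u] down;
    for [t = 0], [s = 1] and [s = -1] suffice. *)
Lemma set_sign_subgradient (R : realType) (t u : R) :
  set_sign t u <-> (forall s, `|t| + u * s <= `|s + t|).
Proof.
have tri (w : R) : w <= `|w| /\ - w <= `|w|.
  by split; [exact: ler_norm|rewrite -normrN ler_norm].
rewrite /set_sign; case: ltgtP => [t0|t0|t0] /=.
- split=> [-> s|sub].
    by rewrite gtr0_norm // mul1r addrC; case: (tri (s + t)).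
  have h1 := sub t; have h2 := sub (- t).
  have tt : 0 < t + t by lra.
  rewrite addNr normr0 (gtr0_norm t0) (gtr0_norm tt) in h1 h2.
  apply: (mulIf (lt0r_neq0 t0)); lra.
- split=> [-> s|sub].
    by rewrite ltr0_norm // mulN1r -opprD addrC; case: (tri (s + t)).
  have h1 := sub t; have h2 := sub (- t).
  have tt : t + t < 0 by lra.
  rewrite addNr normr0 (ltr0_norm t0) (ltr0_norm tt) in h1 h2.
  apply: (mulIf (ltr0_neq0 t0)); lra.
- rewrite -t0 normr0 in_itv /=; split=> [/andP[u1 u2] s|sub].
    rewrite add0r addr0; have [s0|s0] := leP 0 s.
      rewrite ger0_norm //; nra.
    rewrite ltr0_norm //; nra.
  have h1 := sub 1; have h2 := sub (- 1).
  rewrite !addr0 normrN normr1 in h1 h2; apply/andP; split; lra.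
Qed.

(** * Optimality for the objective function *)

Section Objective.
Context (R : realType) (M N : nat) (phi : R -> R -> R) (lambda : R).
Variables (H : 'M[R]_(M, N)) (y : 'cV[R]_M) (a : R * R).
Implicit Types (x d h : 'cV[R]_N).

Definition l1norm x : R := \sum_i `|x i 0|.

Definition smooth_part x : R :=
  2^-1 * sqr_norm2 (y - H *m x) + lambda * Theta phi a x.

Lemma sum_entries x (F : R -> R) : F 0 = 0 ->
  \sum_(1 <= k < N.+2) F (entry x k) = \sum_i F (x i 0).
Proof.
move=> F0; rewrite big_nat_recr //= [F _](_ : _ = 0); last first.
  by rewrite -[RHS]F0; congr F; exact: entry_last.
rewrite addr0 big_add1 big_mkord.
by apply: eq_bigr => i _; rewrite entry_ord.
Qed.

Lemma sum_prev_entries x (F : R -> R) : F 0 = 0 ->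
  \sum_(1 <= k < N.+2) F (entry x k.-1) = \sum_i F (x i 0).
Proof.
move=> F0; rewrite big_add1 /= big_nat_recl //= F0 add0r big_mkord.
by apply: eq_bigr => i _; rewrite valK.
Qed.

(** Each [`|x i 0|] occurs in two adjacent pairs, which cancels the factor 1/2
    in front of the sum of penalties. *)
Lemma objective_split x :
  objective phi lambda H y a x = smooth_part x + lambda * l1norm x.
Proof.
rewrite /objective /smooth_part /Theta /l1norm -addrA; congr (_ + _).
rewrite /bivariate_penalty !big_split /=.
rewrite (sum_entries x (normr0 _)) (sum_prev_entries x (normr0 _)).
by field.
Qed.

Lemma l1norm_convex : 0 <= lambda ->
  convex_function setT (fun x => lambda * l1norm x).
Proof.
move=> l0 t x z _ _.
have t0 : 0 <= t%:num by [].
have t1 : 0 <= 1 - t%:num by rewrite subr_ge0.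
change (lambda * l1norm (t%:num *: x + (1 - t%:num) *: z) <=
  t%:num * (lambda * l1norm x) + (1 - t%:num) * (lambda * l1norm z)).
rewrite !(mulrCA _ lambda) -mulrDr ler_wpM2l // /l1norm !mulr_sumr -big_split.
apply: ler_sum => i _; rewrite !mxE (le_trans (ler_normD _ _)) //.
by rewrite !normrM (ger0_norm t0) (ger0_norm t1).
Qed.

Lemma is_diff_residual x : is_diff x (fun x => 2^-1 * sqr_norm2 (y - H *m x))
  (fun h => - (h^T *m (H^T *m (y - H *m x))) 0 0).
Proof.
have dHx (i : 'I_M) : is_diff x (fun x => (H *m x) i 0) (fun h => (H *m h) i 0).
  have dcoord (j : 'I_N) : is_diff x (fun x => x j 0) (fun h => h j 0).
    apply: is_diff_linear => [c u v|]; last exact: coord_continuous.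
    by rewrite !mxE.
  have := is_diff_sum (index_enum 'I_N) (fun j => is_diffZ (H i j) (dcoord j)).
  by congr (is_diff_def _ _ _); apply/funext => h; rewrite mxE.
have dr (i : 'I_M) := is_diffX 1 (is_diffB (is_diff_cst (y i 0) x) (dHx i)).
have := is_diffZ 2^-1 (is_diff_sum (index_enum 'I_M) dr).
congr (is_diff_def _ _ _); apply/funext => h.
  rewrite !fctE; congr (_ * _); apply: eq_bigr => i _.
  by rewrite !fctE 2![in RHS]mxE.
rewrite !fctE mulmxA -trmx_mul mxE -sumrN.
rewrite [LHS]mulr_sumr; apply: eq_bigr => i _.
rewrite !fctE !mxE expr1 /GRing.scale /= [0 h](_ : _ = 0 :> R) //.
by field.
Qed.

Hypothesis dS : forall z, differentiable (bivariate_S phi a) z.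

Lemma smooth_part_diff x : differentiable smooth_part x /\
  forall h, 'd smooth_part x h = \sum_n h n 0 *
    (lambda * gradient (Theta phi a) x n 0 - (H^T *m (y - H *m x)) n 0).
Proof.
have [dT _] := is_diff_Theta x dS.
have [dF dFE] := is_diffD (is_diff_residual x)
                   (is_diffZ lambda (differentiableP dT)).
split=> // h; rewrite [LHS](congr1 (fun f => f h) dFE) !fctE.
rewrite diff_gradient // mxE -sumrN /GRing.scale /= mulr_sumr -big_split.
by apply: eq_bigr => n _; rewrite !mxE /=; ring.
Qed.

End Objective.

(** The subgradient inequality of the l1 norm follows by summing those of the
    absolute value, and directions along a coordinate axis recover each of
    them. *)
Lemma l1norm_subgradient (R : realType) (N : nat) (x u : 'cV[R]_N) :
  (forall d : 'cV[R]_N, l1norm x + \sum_n u n 0 * d n 0 <= l1norm (d + x)) <->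
  (forall n, set_sign (x n 0) (u n 0)).
Proof.
split=> [sub n|sgn d]; last first.
  rewrite /l1norm -big_split; apply: ler_sum => n _; rewrite !mxE.
  by apply: (set_sign_subgradient _ _).1.
apply/set_sign_subgradient => s.
have := sub (s *: delta_mx n 0).
have splitn (F : 'I_N -> R) : \sum_i F i = F n + \sum_(i | i != n) F i.
  by rewrite (bigD1 n).
have off i : i != n -> (s *: delta_mx n 0 : 'cV[R]_N) i 0 = 0.
  by move=> /negPf ni; rewrite !mxE ni mulr0.
have on : (s *: delta_mx n 0 : 'cV[R]_N) n 0 = s by rewrite !mxE !eqxx mulr1.
rewrite /l1norm (splitn (fun i => `|x i 0|)).
rewrite (splitn (fun i => u i 0 * (s *: delta_mx n 0 : 'cV[R]_N) i 0)) on.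
rewrite (splitn (fun i => `|(s *: delta_mx n 0 + x) i 0|)).
rewrite [\sum_(i | i != n) u i 0 * _]big1 => [|i /off ->]; last exact: mulr0.
rewrite [(_ + x) n 0]mxE on addr0 addrAC.
rewrite [X in _ <= _ + X](eq_bigr (fun i => `|x i 0|)) ?lerD2r //.
by move=> i /off offi; rewrite mxE offi add0r.
Qed.

Theorem theorem5 (R : realType) (M N : nat) (phi : R -> R -> R) (lambda : R)
    (H : 'M[R]_(M, N)) (y : 'cV[R]_M) (a : R * R)
    (hphi : univariate_penalty phi) (hN : (2 < N)%N) (hlambda : 0 < lambda)
    (ha1 : 0 <= a.1) (ha2 : 0 <= a.2) :
  [/\ forall z : R * R, differentiable (bivariate_S phi a) z,
      forall x : 'cV[R]_N, differentiable (Theta phi a) x,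
      forall (x : 'cV[R]_N) (n : 'I_N),
        gradient (Theta phi a) x n 0 =
          2^-1 * partial1 (bivariate_S phi a) (entry x n.+1, entry x n.+2) +
          2^-1 * partial2 (bivariate_S phi a) (entry x n, entry x n.+1)
    & convex_function setT (objective phi lambda H y a) ->
      forall xopt : 'cV[R]_N,
        (forall x : 'cV[R]_N,
           objective phi lambda H y a xopt <= objective phi lambda H y a x) <->
        (forall n : 'I_N,
           set_sign (xopt n 0)
             (lambda^-1 * (H^T *m (y - H *m xopt)) n 0 -
              gradient (Theta phi a) xopt n 0))].
Proof.
have dS z : differentiable (bivariate_S phi a) z.
  exact: bivariate_S_differentiable.
split=> //.
- by move=> x; case: (is_diff_Theta x dS).
- by move=> x n; exact: gradient_Theta.
have -> : objective phi lambda H y a =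
    (fun x => smooth_part phi lambda H y a x + lambda * l1norm x).
  by apply/funext => x; exact: objective_split.
move=> cF x; have [dG dGE] := smooth_part_diff lambda H y dS x.
apply: iff_trans (convex_composite_min dG (l1norm_convex (ltW hlambda)) cF) _.
pose u := \col_n (lambda^-1 * (H^T *m (y - H *m x)) n 0 -
              gradient (Theta phi a) x n 0).
have dGu d : 'd (smooth_part phi lambda H y a) x d =
    - (lambda * \sum_n u n 0 * d n 0).
  rewrite dGE mulr_sumr -sumrN; apply: eq_bigr => n _; rewrite [u n 0]mxE.
  by field; rewrite gt_eqF.
have subE d : (lambda * l1norm x <= lambda * l1norm (d + x) +
      'd (smooth_part phi lambda H y a) x d) =
    (l1norm x + \sum_n u n 0 * d n 0 <= l1norm (d + x)).
  by rewrite dGu -mulrBr ler_pM2l // lerBrDr.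
have [toS toL] := l1norm_subgradient x u.
split=> [sub n|sgn d].
  have : set_sign (x n 0) (u n 0) by apply: toS => d; rewrite -subE.
  by rewrite [u n 0]mxE.
by rewrite subE; apply: toL => n; rewrite [u n 0]mxE.
Qed.
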